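(* For each positive integer $n$, let $f(n)$ denote the number of cops needed to win Covering on the grid $[n]^2$, and let $g(n)$ denote the number of cops needed to win Covering on the torus $[n]^2$ (in both cases against a robber of speed $2$). Then $\frac14 f(n)\le g(n)\le 4f(n)$.
   Context: The grid $[n]^2$ is the graph with vertex set $\{1,\dots,n\}^2$ in which two distinct vertices are adjacent if and only if each coordinate differs by at most $1$. The torus $[n]^2$ is the graph with the same vertex set $\{1,\dots,n\}^2$ in which two distinct vertices are adjacent if and only if each coordinate differs by at most $1$ modulo $n$. The game of Covering on a graph $G$ is a perfect information game played by a team of cops and one robber, each occupying vertices of $G$ (several cops may occupy the same vertex). The cops choose the starting configuration, meaning the initial vertices of all the cops and of the robber. The two sides then take turns alternately forever, the cops going first. On the cops' turn, each cop moves to an adjacent vertex or stays put. On the robber's turn, he moves to any vertex at graph distance at most $2$ from his current vertex (possibly staying put). The cops win if after every one of their turns at least one cop occupies the same vertex as the robber. A number $m$ of cops ''can win'' if $m$ cops have a strategy guaranteeing this against every play of the robber; the number of cops needed to win Covering on $G$ is the minimum such $m$. *)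

(* Defs.v *)
From mathcomp Require Import all_boot.
From mathcomp Require Import boolp classical_sets.

Set Implicit Arguments.
Unset Strict Implicit.
Unset Printing Implicit Defensive.

(* The vertex set {1, ..., n}^2 is rendered as 'I_n * 'I_n, whose coordinates
   are shifted down by one; neither adjacency depends on this shift. *)

Definition grid_adj (n : nat) : rel ('I_n * 'I_n) := fun u v =>
  let close (i j : 'I_n) := (i <= j.+1) && (j <= i.+1) in
  [&& u != v, close u.1 v.1 & close u.2 v.2].

Definition torus_adj (n : nat) : rel ('I_n * 'I_n) := fun u v =>
  let close (i j : 'I_n) :=
    [|| i == j, i.+1 == j %[mod n] | j.+1 == i %[mod n]] in
  [&& u != v, close u.1 v.1 & close u.2 v.2].

Section Covering.

Variables (T : finType) (adj : rel T).

Definition dist_le (k : nat) (u v : T) : Prop :=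
  exists p : seq T, [/\ path adj u p, last u p = v & size p <= k].

Variable m : nat.

Definition config : Type := {ffun 'I_m -> T}.

Definition cops_move (c c' : config) : Prop :=
  forall i, c' i = c i \/ adj (c i) (c' i).

(* Positions of the cops and of the robber just before the cops' turn number t,
   and before each of the earlier ones, in chronological order. *)
Definition history (c : nat -> config) (r : nat -> T) (t : nat) :
  seq (config * T) := mkseq (fun s => (c s, r s)) t.+1.

(* In round t the cops move from c t to c t.+1, and then the robber moves from
   r t to r t.+1; hence a cop has to be at r t after the cops' turn. *)
Definition cops_can_win : Prop :=
  exists (c0 : config) (r0 : T) (strategy : seq (config * T) -> config),
  forall (c : nat -> config) (r : nat -> T),
    c 0 = c0 -> r 0 = r0 ->
    (forall t, dist_le 2 (r t) (r t.+1)) ->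
    (forall t, c t.+1 = strategy (history c r t)) ->
    forall t, cops_move (c t) (c t.+1) /\ exists i, c t.+1 i = r t.

End Covering.

(* The default value 0 is only relevant for a graph without vertices,
   see covering_numberP. *)
Definition covering_number (T : finType) (adj : rel T) : nat :=
  xget 0 [set m | cops_can_win adj m /\
                  forall k, cops_can_win adj k -> m <= k].

Lemma cops_can_win_card (T : finType) (adj : rel T) :
  0 < #|T| -> cops_can_win adj #|T|.
Proof.
move=> /card_gt0P[x _]; pose c0 : config T #|T| := [ffun i => enum_val i].
exists c0, x, (fun=> c0) => c r c00 _ _ cS.
have cE t : c t = c0 by case: t => [|t]; rewrite ?c00 ?cS.
move=> t; rewrite !cE; split; first by move=> i; left.
by exists (enum_rank (r t)); rewrite ffunE enum_rankK.
Qed.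

Lemma covering_numberP (T : finType) (adj : rel T) :
  0 < #|T| ->
  cops_can_win adj (covering_number adj) /\
  forall k, cops_can_win adj k -> covering_number adj <= k.
Proof.
move=> T0; have ex : exists m, `[< cops_can_win adj m >].
  by exists #|T|; apply/asboolP/cops_can_win_card.
case: (ex_minnP ex) => m /asboolP mwin mmin.
apply: (@xgetPex _ 0 [set m | cops_can_win adj m /\
                     forall k, cops_can_win adj k -> m <= k]).
by exists m; split=> // k /asboolP/mmin.
Qed.

(* Main.v *)
Require Import Defs.
From mathcomp Require Import all_boot all_order all_algebra.
From mathcomp Require Import zify lra.

Set Implicit Arguments.
Unset Strict Implicit.
Unset Printing Implicit Defensive.

Import Order.TTheory GRing.Theory Num.Theory.
Local Open Scope ring_scope.

(** Strategies are transferred between the two graphs along maps that send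
    every edge to an edge or to a single vertex. Let [psi] be such a map from
    [H] to [G], and let [phi k], for [k] in a finite type [K], be such maps
    from [G] to [H], with the property that every vertex [v] of [H] is equal to
    [phi k (psi v)] for some [k]. If [m] cops win on [G], then [#|K| * m] cops
    win on [H]: they imagine the game on [G] against the shadow [psi r] of
    the robber, and for every imagined cop [x] they place a real cop on each of
    the vertices [phi k x]. When [x] is on the shadow, one of them is on the
    robber. This is [cops_can_win_transfer].

    Both inequalities come from the reflection [i |-> n - 1 - i]. It is an
    automorphism of the path and of the cycle on [0, ..., n - 1], and replacing
    [i] by the smaller (or by the larger) of [i] and its mirror image folds the
    cycle into the path, because the wrap-around edge joins two vertices that
    are mirror images of each other.
    - From the torus to the grid, [psi] is the identity and the [phi k] are the
      four products of folds: a vertex is fixed by one of them.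
    - From the grid to the torus, [psi] is a product of folds and the [phi k]
      are the four products of reflections: a fold only ever reflects a
      coordinate, and this can be undone. *)

(** * Transferring strategies between graphs *)

Definition weak_hom (G H : finType) (adjG : rel G) (adjH : rel H)
    (phi : G -> H) : Prop :=
  forall u v, adjG u v -> phi v = phi u \/ adjH (phi u) (phi v).

Lemma dist_le_weak_hom (G H : finType) (adjG : rel G) (adjH : rel H)
    (phi : G -> H) (k : nat) (u v : G) :
  weak_hom adjG adjH phi ->
  dist_le adjG k u v -> dist_le adjH k (phi u) (phi v).
Proof.
move=> hom [p [pP <- sp]].
suff [q [qP ql sq]] : dist_le adjH (size p) (phi u) (phi (last u p)).
  by exists q; split=> //; apply: leq_trans sp.
elim: p u pP {sp} => [|w p IHp] u /=; first by move=> _; exists [::].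
case/andP=> /hom uw /IHp[q [qP ql sq]].
case: uw => [e | uw]; first by exists q; rewrite -e; split=> //; apply: leqW.
by exists (phi w :: q); rewrite /= uw.
Qed.

Section Replay.

Variables (T : finType) (m : nat) (c0 : config T m).
Variable strategy : seq (config T m * T) -> config T m.

Definition next_config (h : seq (config T m * T)) : config T m :=
  if h is [::] then c0 else strategy h.

(** The moves of the robber determine the whole play, so that players of
    another game, who only see the robber, can recover it. *)
Definition replay : seq T -> seq (config T m * T) :=
  foldl (fun h x => rcons h (next_config h, x)) [::].

Definition replay_config (r : nat -> T) (t : nat) : config T m :=
  next_config (replay (mkseq r t)).

Lemma history_replay (r : nat -> T) (t : nat) :
  history (replay_config r) r t = replay (mkseq r t.+1).
Proof.
have replayS s : replay (mkseq r s.+1) =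
    rcons (replay (mkseq r s)) (replay_config r s, r s).
  by rewrite mkseqS /replay foldl_rcons.
rewrite /history; elim: t => [|t IHt]; first by rewrite replayS.
by rewrite mkseqS IHt [RHS]replayS.
Qed.

Lemma replay_configS (r : nat -> T) (t : nat) :
  replay_config r t.+1 = strategy (history (replay_config r) r t).
Proof. by rewrite /replay_config -history_replay. Qed.

End Replay.

(** The imagined game has to start where the winning strategy on [G] wants the
    robber to be, hence [psi] may depend on this vertex, which must lie in its
    image. *)
Lemma cops_can_win_transfer (G H K : finType) (adjG : rel G) (adjH : rel H)
    (phi : K -> G -> H) (m : nat) :
  (forall k, weak_hom adjG adjH (phi k)) ->
  (forall x : G, exists psi : H -> G, [/\ weak_hom adjH adjG psi,
     exists y, psi y = x & forall v, exists k, phi k (psi v) = v]) ->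
  cops_can_win adjG m -> cops_can_win adjH (#|K| * m).
Proof.
move=> phi_hom psiP [c0 [x [S winS]]].
have [psi [psi_hom [y psiy] psiK]] := psiP x.
have <- : #|{: K * 'I_m}| = (#|K| * m)%N by rewrite card_prod card_ord.
pose spread (c : config G m) : config H #|{: K * 'I_m}| :=
  [ffun i => let: (k, j) := enum_val i in phi k (c j)].
exists (spread c0), y,
  (fun h => spread (next_config c0 S (replay c0 S [seq psi z.2 | z <- h]))).
move=> c r c_0 r_0 r_dist cS.
pose d := replay_config c0 S (psi \o r).
have cE t : c t = spread (d t).
  case: t => [|t]; first by rewrite c_0.
  by rewrite cS /history -map_comp.
have winD t : cops_move adjG (d t) (d t.+1) /\ exists i, d t.+1 i = psi (r t).
  apply: (winS d (psi \o r)) => //=; first by rewrite r_0.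
    by move=> s; apply: dist_le_weak_hom psi_hom _.
  exact: replay_configS.
move=> t; have [d_move [j dj]] := winD t; rewrite !cE; split.
  move=> i; rewrite !ffunE; case: (enum_val i) => k l.
  by case: (d_move l) => [->|/phi_hom]; first by left.
have [k phik] := psiK (r t).
by exists (enum_rank (k, j)); rewrite ffunE enum_rankK dj.
Qed.

Lemma covering_number_transfer (G H K : finType) (adjG : rel G)
    (adjH : rel H) (phi : K -> G -> H) :
  (0 < #|G|)%N -> (0 < #|H|)%N ->
  (forall k, weak_hom adjG adjH (phi k)) ->
  (forall x : G, exists psi : H -> G, [/\ weak_hom adjH adjG psi,
     exists y, psi y = x & forall v, exists k, phi k (psi v) = v]) ->
  (covering_number adjH <= #|K| * covering_number adjG)%N.
Proof.
move=> G0 H0 phi_hom psiP; have [_ minH] := covering_numberP adjH H0.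
have [winG _] := covering_numberP adjG G0.
exact/minH/(cops_can_win_transfer phi_hom psiP).
Qed.

(** * Folding and reflecting the cycle *)

Section Fold.

Variable n : nat.
Implicit Types (i j : 'I_n) (b : bool) (k : bool * bool).

Definition path_close i j : bool := (i <= j.+1)%N && (j <= i.+1)%N.

Definition cycle_close i j : bool :=
  [|| i == j, i.+1 == j %[mod n] | j.+1 == i %[mod n]].

Definition reflect_ord b i : 'I_n := if b then rev_ord i else i.

(** This is the minimum of [i] and its mirror image if [b] holds, and their
    maximum otherwise. *)
Definition fold_ord b i : 'I_n := reflect_ord (b != (i <= rev_ord i)%N) i.

Lemma fold_ord_id i : fold_ord (i <= rev_ord i)%N i = i.
Proof. by rewrite /fold_ord eqxx. Qed.

Lemma reflect_ordK b : involutive (reflect_ord b).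
Proof. by case: b => // i; apply: rev_ordK. Qed.

Lemma succ_modP i j :
  i.+1 == j %[mod n] -> j = i.+1 :> nat \/ i.+1 = n /\ j = 0%N :> nat.
Proof.
rewrite (modn_small (ltn_ord j)).
have := ltn_ord i; rewrite leq_eqVlt => /orP[/eqP e | lt].
  by rewrite e modnn => /eqP <-; right.
by rewrite modn_small // => /eqP <-; left.
Qed.

Lemma fold_ord_close b i j :
  cycle_close i j -> path_close (fold_ord b i) (fold_ord b j).
Proof.
have [ltin ltjn] := (ltn_ord i, ltn_ord j).
rewrite /path_close /fold_ord /reflect_ord.
case/or3P=> [/eqP -> | /succ_modP ij | /succ_modP ji].
- by rewrite leqnSn.
- by case: b; case: (leqP i (rev_ord i)); case: (leqP j (rev_ord j)) => /=; lia.
- by case: b; case: (leqP i (rev_ord i)); case: (leqP j (rev_ord j)) => /=; lia.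
Qed.

Lemma reflect_ord_close b i j :
  path_close i j -> cycle_close (reflect_ord b i) (reflect_ord b j).
Proof.
have [ltin ltjn] := (ltn_ord i, ltn_ord j) => /andP[ij ji].
have : [\/ i = j :> nat, i.+1 = j :> nat | j.+1 = i :> nat].
  by case: (ltngtP i j) => ?; [apply: Or32 | apply: Or33 | apply: Or31]; lia.
rewrite /cycle_close; case=> [/val_inj -> | e | e]; first by rewrite eqxx.
  case: b => /=; last by rewrite e eqxx orbT.
  have -> : (n - j.+1).+1 = (n - i.+1)%N by lia.
  by rewrite eqxx !orbT.
case: b => /=; last by rewrite e eqxx !orbT.
have -> : (n - i.+1).+1 = (n - j.+1)%N by lia.
by rewrite eqxx !orbT.
Qed.

(** * Folding the torus into the grid *)

Definition map_coords (a : bool -> 'I_n -> 'I_n) k (u : 'I_n * 'I_n) :=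
  (a k.1 u.1, a k.2 u.2).

Lemma fold_weak_hom k :
  weak_hom (@torus_adj n) (@grid_adj n) (map_coords fold_ord k).
Proof.
move=> u v /and3P[_ uv1 uv2].
have c1 := fold_ord_close k.1 uv1; have c2 := fold_ord_close k.2 uv2.
have [->|ne] := eqVneq (map_coords fold_ord k u) (map_coords fold_ord k v).
  by left.
by right; apply/and3P.
Qed.

Lemma reflect_weak_hom k :
  weak_hom (@grid_adj n) (@torus_adj n) (map_coords reflect_ord k).
Proof.
move=> u v /and3P[_ uv1 uv2].
have c1 := reflect_ord_close k.1 uv1; have c2 := reflect_ord_close k.2 uv2.
have [->|ne] := eqVneq (map_coords reflect_ord k u)
                       (map_coords reflect_ord k v).
  by left.
by right; apply/and3P.
Qed.

Lemma grid_torus_weak_hom : weak_hom (@grid_adj n) (@torus_adj n) id.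
Proof.
by move=> [u1 u2] [v1 v2]; apply: (@reflect_weak_hom (false, false)).
Qed.

Lemma fold_fixed (v : 'I_n * 'I_n) : exists k, map_coords fold_ord k v = v.
Proof.
case: v => i j; exists ((i <= rev_ord i)%N, (j <= rev_ord j)%N).
by rewrite /map_coords !fold_ord_id.
Qed.

Lemma reflect_fold k (v : 'I_n * 'I_n) :
  exists l, map_coords reflect_ord l (map_coords fold_ord k v) = v.
Proof.
case: v => i j.
exists (k.1 != (i <= rev_ord i)%N, k.2 != (j <= rev_ord j)%N).
by rewrite /map_coords !reflect_ordK.
Qed.

Lemma card_square_gt0 : (0 < n)%N -> (0 < #|{: 'I_n * 'I_n}|)%N.
Proof. by move=> n_gt0; rewrite card_prod card_ord muln_gt0 n_gt0. Qed.

Lemma covering_number_grid_le : (0 < n)%N ->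
  (covering_number (@grid_adj n) <= 4 * covering_number (@torus_adj n))%N.
Proof.
move=> /card_square_gt0 sq_gt0; have <- : #|{: bool * bool}| = 4%N.
  by rewrite card_prod card_bool.
apply: covering_number_transfer fold_weak_hom _ => // x.
by exists id; split; [exact: grid_torus_weak_hom | exists x | exact: fold_fixed].
Qed.

Lemma covering_number_torus_le : (0 < n)%N ->
  (covering_number (@torus_adj n) <= 4 * covering_number (@grid_adj n))%N.
Proof.
move=> /card_square_gt0 sq_gt0; have <- : #|{: bool * bool}| = 4%N.
  by rewrite card_prod card_bool.
apply: covering_number_transfer reflect_weak_hom _ => // x.
(* The quarter onto which the torus is folded is chosen to contain [x]. *)
have [k kx] := fold_fixed x; exists (map_coords fold_ord k).
by split; [exact: fold_weak_hom | exists x | exact: reflect_fold].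
Qed.

End Fold.

Theorem theorem1p3 (n : nat) (n_gt0 : (0 < n)%N) :
  let f : rat := (covering_number (@grid_adj n))%:R in
  let g : rat := (covering_number (@torus_adj n))%:R in
  1 / 4 * f <= g <= 4 * f.
Proof.
cbv zeta; set f : rat := _%:R; set g : rat := _%:R.
have fg : f <= 4 * g by rewrite -natrM ler_nat covering_number_grid_le.
have gf : g <= 4 * f by rewrite -natrM ler_nat covering_number_torus_le.
by apply/andP; split; lra.
Qed.
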